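(* Let $n,b$ be natural numbers with $1<n<b$, let $k\ge 0$, and let $\sigma,\tau,\pi$ be permutations of $\{0,1,\ldots,k\}$. Let $(d_k,\ldots,d_0)_b$ be an $(n,b,\sigma)$-permutiple with carries $c_k,\ldots,c_0$, and let $(d_{\pi(k)},d_{\pi(k-1)},\ldots,d_{\pi(0)})_b$ be an $(n,b,\tau)$-permutiple with carries $c_{\pi(k)},c_{\pi(k-1)},\ldots,c_{\pi(0)}$. Then $n d_{\sigma(j)}\equiv n d_{\pi\tau\pi^{-1}(j)} \pmod b$ for all $0\le j\le k$.
   Context: For integers $0\le d_j<b$, $(d_k,d_{k-1},\ldots,d_0)_b$ denotes the natural number $\sum_{j=0}^k d_j b^j$ (leading zeros are allowed). For a permutation $\sigma$ of $\{0,1,\ldots,k\}$, $(d_k,\ldots,d_0)_b$ is an $(n,b,\sigma)$-permutiple if $(d_k,d_{k-1},\ldots,d_0)_b = n\,(d_{\sigma(k)},d_{\sigma(k-1)},\ldots,d_{\sigma(0)})_b$. Accordingly, $(d_{\pi(k)},\ldots,d_{\pi(0)})_b$ is an $(n,b,\tau)$-permutiple if $(d_{\pi(k)},\ldots,d_{\pi(0)})_b=n\,(d_{\pi\tau(k)},\ldots,d_{\pi\tau(0)})_b$. The carries of an $(n,b,\sigma)$-permutiple $(d_k,\ldots,d_0)_b$ are those of the usual single-digit multiplication of $(d_{\sigma(k)},\ldots,d_{\sigma(0)})_b$ by $n$ in base $b$: $c_0=0$ and $c_{j+1}=\left[n d_{\sigma(j)}+c_j-\lambda(n d_{\sigma(j)}+c_j)\right]/b$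 for $0\le j\le k$, where $\lambda(x)$ is the least non-negative residue of $x$ modulo $b$; since the product has $k+1$ digits, $c_{k+1}=0$. (For the permuted number, $d_{\sigma(j)}$ is replaced by $d_{\pi\tau(j)}$.) ''With carries $c_{\pi(k)},\ldots,c_{\pi(0)}$'' means the $j$th carry is $c_{\pi(j)}$. Products of permutations are compositions, applied right to left. *)

(* Defs.v *)
From mathcomp Require Import all_boot all_fingroup.

Set Implicit Arguments.
Unset Strict Implicit.
Unset Printing Implicit Defensive.

Section Permutiples.

Variable k : nat.
Implicit Types (n b : nat) (d e : 'I_k.+1 -> nat) (s : {perm 'I_k.+1}).

(* (d_k, ..., d_0)_b ; index 0 is the least significant digit. *)
Definition base_value b d : nat := \sum_(j < k.+1) d j * b ^ j.

Definition permutiple n b s d : Prop :=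
  (forall j, d j < b) /\ base_value b d = n * base_value b (d \o s).

(* The j-th carry when (e_k, ..., e_0)_b is multiplied by the single digit n.
   The recursion reads e at inord i, which is the index i for i <= k, so the
   values are meaningful for j <= k.+1. *)
Fixpoint carry n b e (j : nat) : nat :=
  if j is i.+1 then
    let x := n * e (inord i) + carry n b e i in (x - x %% b) %/ b
  else 0.

(* c_k, ..., c_0 are the carries of (d_k, ..., d_0)_b, as an
   (n, b, s)-permutiple: it is the digits d_(s j) that are multiplied by n. *)
Definition has_carries n b s d (c : 'I_k.+1 -> nat) : Prop :=
  forall j : 'I_k.+1, c j = carry n b (d \o s) j.

End Permutiples.

(* Main.v *)
Require Import Defs.
From mathcomp Require Import all_boot all_fingroup.

Set Implicit Arguments.
Unset Strict Implicit.
Unset Printing Implicit Defensive.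

(** Long multiplication reads the digits of a product off the carries: the
    [j]-th digit of [n * (e_k, ..., e_0)_b] is [(n * e_j + c_j) %% b].  For a
    permutiple the digits of the product are also the [d_j], and base [b]
    digits are unique, so [d_j] is the residue of [n * d_(sigma j) + c_j]
    modulo [b] ([permutiple_digit]).

    The permuted number gives, at position [i], that [d_(pi i)] is the residue
    of [n * d_(pi (tau i)) + c_(pi i)]; taking [i = pi^-1 j] produces a second
    expression for [d_j], with the same carry [c_j].  Cancelling the carry
    between the two expressions leaves the claimed congruence. *)

(** The term [C * b ^ m] absorbs an overflow of the second number: congruence
    modulo [b ^ m] already determines the digits.  In this form the lemma
    applies to a product before its last carry is known to vanish. *)
Lemma digits_unique (b m C : nat) (f g : nat -> nat) :
  (forall i, i < m -> f i < b) -> (forall i, i < m -> g i < b) ->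
  \sum_(i < m) f i * b ^ i = \sum_(i < m) g i * b ^ i + C * b ^ m ->
  forall i, i < m -> f i = g i.
Proof.
elim: m f g => [|m IHm] f g f_lt g_lt //.
have shift (h : nat -> nat) : \sum_(i < m.+1) h i * b ^ i =
    (\sum_(i < m) h i.+1 * b ^ i) * b + h 0.
  rewrite big_ord_recl muln1 addnC big_distrl /=; congr (_ + _).
  by apply: eq_bigr => i _; rewrite expnSr mulnA.
rewrite !shift expnSr mulnA addnAC -mulnDl => eq_fg.
have b_gt0 : 0 < b by apply: leq_ltn_trans (f_lt 0 _).
have f0_g0 : f 0 = g 0.
  move/(congr1 (modn^~ b)): eq_fg.
  by rewrite /= !modnMDl !modn_small ?f_lt ?g_lt.
case=> [|i] // lt_im.
apply: (IHm (f \o succn) (g \o succn) (fun i => f_lt i.+1)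
  (fun i => g_lt i.+1)) => //=.
by move/eqP: eq_fg; rewrite f0_g0 eqn_add2r eqn_pmul2r // => /eqP.
Qed.

(** Invariant of the multiplication algorithm: after [m] steps the carry holds
    exactly what the [m] digits written so far leave out of the product. *)
Lemma mul_base_carry (k n b m : nat) (e : 'I_k.+1 -> nat) :
  n * (\sum_(i < m) e (inord i) * b ^ i) =
  \sum_(i < m) ((n * e (inord i) + carry n b e i) %% b) * b ^ i
    + carry n b e m * b ^ m.
Proof.
elim: m => [|m IHm]; first by rewrite !big_ord0 muln0.
rewrite !big_ord_recr /= mulnDr IHm expnS -!addnA; congr (_ + _).
set x := n * _ + _.
have -> : (x - x %% b) %/ b * (b * b ^ m) = (x - x %% b) * b ^ m.
  by rewrite mulnA divnK // {1}(divn_eq x b) addnK dvdn_mull.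
by rewrite -mulnDl subnKC ?leq_mod // mulnDl addnC mulnA.
Qed.

Lemma base_value_inord (k b : nat) (e : 'I_k.+1 -> nat) :
  base_value b e = \sum_(i < k.+1) e (inord i) * b ^ i.
Proof. by apply: eq_bigr => i _; rewrite inord_val. Qed.

Lemma permutiple_digit (k n b : nat) (s : {perm 'I_k.+1})
    (d c : 'I_k.+1 -> nat) :
  permutiple n b s d -> has_carries n b s d c ->
  forall j, d j = (n * d (s j) + c j) %% b.
Proof.
move=> [d_lt]; rewrite !base_value_inord mul_base_carry => eq_d c_carry j.
have b_gt0 : 0 < b by apply: leq_ltn_trans (d_lt j).
have lt_dig i : (n * (d \o s) (inord i) + carry n b (d \o s) i) %% b < b.
  by rewrite ltn_mod.
have := @digits_unique b k.+1 _ (fun i => d (inord i))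
  (fun i => (n * (d \o s) (inord i) + carry n b (d \o s) i) %% b)
  (fun i _ => d_lt _) (fun i _ => lt_dig i) eq_d j (ltn_ord j).
by rewrite /= inord_val -c_carry.
Qed.

Theorem corollary14 (n b k : nat) (sigma tau pi : {perm 'I_k.+1})
  (d c : 'I_k.+1 -> nat)
  (hn : 1 < n) (hnb : n < b)
  (hd : permutiple n b sigma d)
  (hc : has_carries n b sigma d c)
  (hdpi : permutiple n b tau (d \o pi))
  (hcpi : has_carries n b tau (d \o pi) (c \o pi)) :
  forall j : 'I_k.+1,
    n * d (sigma j) = n * d (pi (tau ((pi^-1)%g j))) %[mod b].
Proof.
move=> j.
have := permutiple_digit hdpi hcpi ((pi^-1)%g j).
rewrite /= permKV (permutiple_digit hd hc j).
by move/eqP; rewrite eqn_modDr => /eqP.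
Qed.
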